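(* Let $\Gamma=\mathbf{c}^{-1}(\mathrm{SO}_3(\mathbb{Z}[i]))\subset\mathrm{SL}_2(\mathbb{C})$ and $\Gamma_{\mathbb R}=\Gamma\cap\mathrm{SL}_2(\mathbb{R})$. Let $\mathcal{G}\subset\mathbb{C}$ be the closed triangle with vertices $1,2,1+i$, let $\mathcal{G}_{\mathbb R}=[0,2]$, and let $$\mathcal F(\mathcal G)=\{z\in\mathbb{H}^3: x(z)\in\mathcal G,\ y(z)\ge y(\gamma z)\ \forall\gamma\in\Gamma\},\qquad \mathcal F_{\mathbb R}(\mathcal G_{\mathbb R})=\{z\in\mathbb{H}^2: x(z)\in\mathcal G_{\mathbb R},\ y(z)\ge y(\gamma z)\ \forall\gamma\in\Gamma_{\mathbb R}\}.$$ Let $T_1=\begin{pmatrix}1&1\\0&1\end{pmatrix}$ and $R_{\pi/2}=\begin{pmatrix}\omega_8&0\\0&\omega_8^{-1}\end{pmatrix}$ with $\omega_8=e^{\pi i/4}$. Then, identifying $\mathbb{H}^2$ with $\mathbb{H}^2_{\mathbf j}\subset\mathbb{H}^3$, $$\mathcal F_{\mathbb R}(\mathcal G_{\mathbb R})=\Bigl(\mathcal F(\mathcal G)\cup \bigl(T_1R_{\pi/2}^2T_1^{-1}\bigr)\mathcal F(\mathcal G)\Bigr)\cap\mathbb{H}^2_{\mathbf j}.$$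
   Context: $\mathbb{H}^3=\{x_1+x_2 i+y\mathbf{j}: x_1,x_2\in\mathbb{R},\ y>0\}$ inside the quaternions; $x(z)=x_1+x_2i\in\mathbb{C}$, $y(z)=y$; $\mathrm{SL}_2(\mathbb{C})$ acts by $z\mapsto(az+b)(cz+d)^{-1}$. $\mathbb{H}^2_{\mathbf j}=\{x_1+y\mathbf j\}$ is the vertical half-plane $x_2=0$, identified with the upper half-plane $\mathbb{H}^2$ by $x_1+y\mathbf j\leftrightarrow x_1+iy$. For $g\in \mathrm{SL}_2(\mathbb{C})$, $\mathbf{c}(g)$ is the matrix of $X\mapsto gXg^{-1}$ on $\mathfrak{sl}_2(\mathbb{C})$ with respect to the basis $X_1=\begin{pmatrix}0&1\\1&0\end{pmatrix}$, $X_2=\begin{pmatrix}0&i\\-i&0\end{pmatrix}$, $Y=\begin{pmatrix}1&0\\0&-1\end{pmatrix}$, orthonormal for $\frac12\mathrm{Tr}(XY)$; $\mathbf c:\mathrm{SL}_2(\mathbb{C})\to\mathrm{SO}_3(\mathbb{C})$ is surjective with kernel $\{\pm I\}$. $\mathrm{SO}_3(\mathbb{Z}[i])$ consists of the matrices of $\mathrm{SO}_3(\mathbb{C})$ with entries in $\mathbb{Z}[i]$. *)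

(* Defs.v *)
From HB Require Import structures.
From mathcomp Require Import all_boot all_order all_algebra.
From mathcomp Require Import complex ring.
From mathcomp Require Import all_classical all_reals all_analysis.

Set Implicit Arguments.
Unset Strict Implicit.
Unset Printing Implicit Defensive.

Import Order.TTheory GRing.Theory Num.Theory.
Local Open Scope classical_set_scope.
Local Open Scope ring_scope.
Local Open Scope complex_scope.

(* Hamilton's quaternions: the pair (u, v) of complex numbers stands for
   u + v j, with j ^ 2 = -1 and j u = u^* j. *)
Definition quat (R : realType) : Type := (R[i] * R[i])%type.

Section Quaternions.
Variable R : realType.
Local Notation H := (quat R).

HB.instance Definition _ := GRing.Zmodule.copy H (R[i] * R[i])%type.

Definition quat_one : H := (1, 0).

Definition quat_mul (p q : H) : H :=
  (p.1 * q.1 - p.2 * q.2^*, p.1 * q.2 + p.2 * q.1^*).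

Definition quat_norm2 (q : H) : R[i] := q.1 * q.1^* + q.2 * q.2^*.

Definition quat_inv (q : H) : H :=
  (q.1^* / quat_norm2 q, - q.2 / quat_norm2 q).

Fact quat_mulA : associative quat_mul.
Proof.
move=> [a b] [c d] [e f]; rewrite /quat_mul /=.
by congr pair; rewrite !(rmorphD, rmorphN, rmorphM) /= conjCK; ring.
Qed.

Fact quat_mul1q : left_id quat_one quat_mul.
Proof. by move=> [a b]; rewrite /quat_mul /=; congr pair; ring. Qed.

Fact quat_mulq1 : right_id quat_one quat_mul.
Proof.
move=> [a b]; rewrite /quat_mul /=.
by congr pair; rewrite ?(rmorph0, rmorph1); ring.
Qed.

Fact quat_mulDl : left_distributive quat_mul +%R.
Proof.
by move=> [a b] [c d] [e f]; rewrite /quat_mul; congr pair => /=; ring.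
Qed.

Fact quat_mulDr : right_distributive quat_mul +%R.
Proof.
move=> [a b] [c d] [e f]; rewrite /quat_mul /=.
by congr pair; rewrite /= rmorphD; ring.
Qed.

Fact quat_one_neq0 : quat_one != 0.
Proof. by apply/eqP => -[/eqP]; rewrite oner_eq0. Qed.

HB.instance Definition _ := GRing.Zmodule_isNzRing.Build H
  quat_mulA quat_mul1q quat_mulq1 quat_mulDl quat_mulDr quat_one_neq0.

Fact quat_norm2_eq0 (q : H) : (quat_norm2 q == 0) = (q == 0).
Proof.
by case: q => u v; rewrite paddr_eq0 ?mul_conjC_ge0 // !mul_conjC_eq0.
Qed.

Fact quat_mulVq : {in (fun q : H => q != 0), left_inverse 1 quat_inv *%R}.
Proof.
move=> [a b]; rewrite unfold_in -quat_norm2_eq0 /quat_norm2 /= => N0.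
rewrite /GRing.mul /GRing.one /= /quat_mul /quat_one /quat_inv /quat_norm2 /=.
by congr pair; field.
Qed.

Fact quat_mulqV : {in (fun q : H => q != 0), right_inverse 1 quat_inv *%R}.
Proof.
move=> [a b]; rewrite unfold_in -quat_norm2_eq0 /quat_norm2 /= => N0.
rewrite /GRing.mul /GRing.one /= /quat_mul /quat_one /quat_inv /quat_norm2 /=.
rewrite !(rmorphM, rmorphN, fmorphV, rmorphD) /= !conjCK.
by congr pair; field; rewrite 1?[X in X + _]mulrC 1?[X in _ + X]mulrC ?N0.
Qed.

Fact quat_unitP (p q : H) : q * p = 1 /\ p * q = 1 -> p != 0.
Proof.
by case=> qp _; apply/eqP => p0; move/eqP: qp;
  rewrite p0 mulr0 eq_sym oner_eq0.
Qed.

Fact quat_inv_out : {in [predC (fun q : H => q != 0)], quat_inv =1 id}.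
Proof.
move=> q; rewrite !unfold_in /= negbK => /eqP ->.
by rewrite /quat_inv /= oppr0 rmorph0 !mul0r.
Qed.

HB.instance Definition _ := GRing.NzRing_hasMulInverse.Build H
  quat_mulVq quat_mulqV quat_unitP quat_inv_out.

Definition quat_of_complex (u : R[i]) : H := (u, 0).

Definition quat_j : H := (0, 1).

End Quaternions.

Section HyperbolicSpaces.
Variable R : realType.
Implicit Types (g : 'M[R[i]]_2) (q : quat R) (z : R[i]).

(* x(q) is the component q.1 and y(q) the real coefficient of j. *)
Definition xH3 q : R[i] := q.1.
Definition yH3 q : R := complex.Re q.2.

Definition H3 : set (quat R) :=
  [set quat_of_complex u + quat_of_complex y%:C * quat_j R
    | u in [set: R[i]] & y in [set y : R | 0 < y]].

Definition actH3 g q : quat R :=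
  (quat_of_complex (g 0 0) * q + quat_of_complex (g 0 1))
  / (quat_of_complex (g 1 0) * q + quat_of_complex (g 1 1)).

Definition H2 : set R[i] := [set z | 0 < complex.Im z].

Definition actH2 g z : R[i] := (g 0 0 * z + g 0 1) / (g 1 0 * z + g 1 1).

(* The identification x1 + i y |-> x1 + y j of H2 with H2j. *)
Definition H2_to_H3 z : quat R :=
  quat_of_complex (complex.Re z)%:C
  + quat_of_complex (complex.Im z)%:C * quat_j R.

Definition H2j : set (quat R) := [set q | H3 q /\ complex.Im (xH3 q) = 0].

End HyperbolicSpaces.

Section Groups.
Variable R : realType.
Local Notation C := R[i].

Definition mx22 (a b c d : C) : 'M[C]_2 :=
  \matrix_(i, j) if i == 0 then if j == 0 then a else b
                 else if j == 0 then c else d.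

Definition SL2 (K : comNzRingType) : set 'M[K]_2 := [set g | \det g = 1].

Definition SL2R : set 'M[C]_2 := map_mx (real_complex R) @` @SL2 R.

(* (X_1, X_2, Y) *)
Definition sl2_basis : 3.-tuple 'M[C]_2 :=
  [tuple mx22 0 1 1 0; mx22 0 (0 +i* 1) (0 -i* 1) 0; mx22 1 0 0 (-1)].

Definition sl2 : {vspace 'M[C]_2} :=
  lker (linfun (@mxtrace C 2 : 'M[C]_2 -> C^o)).

(* The j-th column lists the coordinates of g B_j g^-1. *)
Definition cmx (g : 'M[C]_2) : 'M[C]_3 :=
  \matrix_(i, j) coord sl2_basis i (g *m sl2_basis`_j *m invmx g).

Definition gaussian_int (z : C) : bool :=
  (complex.Re z \is a Num.int) && (complex.Im z \is a Num.int).

Definition SO3 : set 'M[C]_3 := [set A | A^T *m A = 1%:M /\ \det A = 1].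

Definition SO3Zi : set 'M[C]_3 :=
  [set A | SO3 A /\ forall i j, gaussian_int (A i j)].

Definition Gamma : set 'M[C]_2 := @SL2 C `&` (cmx @^-1` SO3Zi).

Definition GammaR : set 'M[C]_2 := Gamma `&` SL2R.

Definition T1 : 'M[C]_2 := mx22 1 1 0 1.

(* e^(i pi / 4), by Euler's formula. *)
Definition omega8 : C := cos (pi / 4) +i* sin (pi / 4).

Definition Rpi2 : 'M[C]_2 := mx22 omega8 0 0 omega8^-1.

End Groups.

Section FundamentalDomains.
Variable R : realType.
Local Notation C := R[i].

Definition triangle (a b c : C) : set C :=
  [set z | exists r s t : R, [/\ 0 <= r, 0 <= s, 0 <= t, r + s + t = 1
                                & z = r%:C * a + s%:C * b + t%:C * c]].

Definition calG : set C := triangle 1 2 (1 +i* 1).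

Definition calGR : set R := `[0, 2].

Definition calF (G : set C) : set (quat R) :=
  [set z | [/\ H3 z, G (xH3 z)
             & forall g, @Gamma R g -> yH3 (actH3 g z) <= yH3 z]].

Definition calFR (G : set R) : set C :=
  [set z | [/\ H2 z, G (complex.Re z)
             & forall g, @GammaR R g -> complex.Im (actH2 g z) <= complex.Im z]].

End FundamentalDomains.

Lemma sl2_basisP (R : realType) : basis_of (sl2 R) (sl2_basis R).
Proof.
have sumE (k : 'I_3 -> R[i]) : \sum_(i < 3) k i *: (sl2_basis R)`_i =
    mx22 (k 2) (k 0 + k 1 * (0 +i* 1)) (k 0 + k 1 * (0 -i* 1)) (- k 2).
  have e1 : lift ord0 ord0 = 1 :> 'I_3 by exact/val_inj.
  have e2 : lift ord0 (lift ord0 ord0) = 2 :> 'I_3 by exact/val_inj.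
  rewrite !big_ord_recl big_ord0 /= e1 e2; apply/matrixP => i j.
  by rewrite !mxE; case: ifP => _; case: ifP => _; ring.
have i2 : (0 +i* 1) * (0 -i* 1) = 1 :> R[i].
  by apply/eqP; rewrite eq_complex /=; apply/andP; split; apply/eqP; ring.
have iN : (0 -i* 1) = - (0 +i* 1) :> R[i].
  by apply/eqP; rewrite eq_complex /= oppr0 !eqxx.
have ii : (0 +i* 1) * (0 +i* 1) = -1 :> R[i].
  by rewrite -i2 iN mulrN opprK.
have two0 : 2 != 0 :> R[i] by rewrite pnatr_eq0.
have mem_sl2 M : (M \in sl2 R) = (\tr M == 0) by rewrite memv_ker lfunE.
apply/andP; split; last first.
  apply/freeP => k; rewrite sumE => /matrixP k0.
  have := k0 0 0; have := k0 0 1; have := k0 1 0.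
  rewrite !mxE /= iN => h10 h01 k2.
  have {}k1 : k 1 = 0.
    apply: (mulIf two0); rewrite mul0r.
    transitivity ((k 0 + k 1 * - (0 +i* 1) - (k 0 + k 1 * (0 +i* 1)))
                  * (0 +i* 1)).
      by rewrite -[LHS]mulr1 -[X in _ * X]opprK -ii; ring.
    by rewrite h10 h01 subr0 mul0r.
  move: h01; rewrite k1 mul0r addr0 => {}h0 i.
  have : i \in enum 'I_3 by rewrite mem_enum.
  rewrite !enum_ordSl enum_ord0 !inE.
  have -> : lift ord0 ord0 = 1 :> 'I_3 by exact/val_inj.
  have -> : lift ord0 (lift ord0 ord0) = 2 :> 'I_3 by exact/val_inj.
  by rewrite /= => /or3P[] /eqP ->.
rewrite eqEsubv; apply/andP; split.
  apply/span_subvP => M; rewrite !inE mem_sl2.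
  by move=> /or3P[] /eqP ->; apply/eqP; rewrite /mxtrace !big_ord_recl big_ord0
    !mxE /=; ring.
apply/subvP => M; rewrite mem_sl2 /mxtrace !big_ord_recl big_ord0 addr0.
have -> : lift ord0 ord0 = 1 :> 'I_2 by exact/val_inj.
rewrite addr_eq0 -[ord0]/(0 : 'I_2) => /eqP tM.
pose k (i : 'I_3) : R[i] := [:: (M 0 1 + M 1 0) / 2;
  (M 1 0 - M 0 1) * (0 +i* 1) / 2; M 0 0]`_i.
suff -> : M = \sum_(i < 3) k i *: (sl2_basis R)`_i.
  by apply: memv_suml => i _; apply/memvZ/memv_span/mem_nth; rewrite size_tuple.
have kE : k 1 * (0 +i* 1) = (M 0 1 - M 1 0) / 2.
  transitivity ((M 1 0 - M 0 1) * ((0 +i* 1) * (0 +i* 1)) / 2).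
    by rewrite /k /=; ring.
  by rewrite ii; ring.
rewrite sumE iN mulrN kE /k /= tM opprK.
apply/matrixP => i j; rewrite !mxE.
have ord2 (l : 'I_2) : (l == 0) = false -> l = 1.
  by case: l => [[|[|]]] // ? _; apply/val_inj.
case: ifP => [/eqP -> | /ord2 ->]; case: ifP => [/eqP -> | /ord2 ->] //.
- by field.
- by field.
Qed.

(* Main.v *)
Require Import Defs.
From mathcomp Require Import all_boot all_order all_algebra.
From mathcomp Require Import complex ring lra.
From mathcomp Require Import all_classical all_reals all_analysis.

(** If (c, d) is the bottom row of an element of Gamma, then c^2 + d^2,
    d^2 - c^2 and 2 c d are Gaussian integers, hence |c|^2 + |d|^2 >= 1 and
    |c|^2 + |d + 2 c|^2 >= 1.  At x + y j with 0 <= x <= 2, the quotient of the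
    heights of z and gamma z is a convex combination of these two quantities
    plus |c|^2 ((x - 1)^2 + y^2 - 2), so it is at least 1 when
    (x - 1)^2 + y^2 >= 2.  Conversely this inequality is forced by the single
    element 2^(-1/2) (1, 1; -1, 1) of Gamma_R.  Hence it cuts out both domains
    in H^2_j, over [0, 2] and [1, 2] respectively, and T_1 R_{pi/2}^2 T_1^{-1}
    sends u + v j to (2 - u) + v j. *)

Set Implicit Arguments.
Unset Strict Implicit.
Unset Printing Implicit Defensive.

Import Order.TTheory GRing.Theory Num.Theory.
Local Open Scope classical_set_scope.
Local Open Scope ring_scope.
Local Open Scope complex_scope.

(** * Explicit entries of the adjoint matrix of a 2 x 2 matrix *)

Section Matrices.
Variable R : realType.
Local Notation C := R[i].
Implicit Types a b c d : C.

Lemma i2_eq1 (i : 'I_2) : (i == 0) = false -> i = 1.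
Proof. by case: i => [[|[|]]] // ? _; apply/val_inj. Qed.

Lemma mx22E (g : 'M[C]_2) : g = mx22 (g 0 0) (g 0 1) (g 1 0) (g 1 1).
Proof.
by apply/matrixP=> i j; rewrite mxE;
  case: ifP => [/eqP -> | /i2_eq1 ->]; case: ifP => [/eqP -> | /i2_eq1 ->].
Qed.

Lemma mx22_mul a b c d a' b' c' d' :
  mx22 a b c d *m mx22 a' b' c' d' =
  mx22 (a * a' + b * c') (a * b' + b * d') (c * a' + d * c') (c * b' + d * d').
Proof.
apply/matrixP=> i j; rewrite !mxE !big_ord_recl big_ord0 addr0 !mxE /=.
by case: ifP => _; case: ifP.
Qed.

Lemma det_mx22 a b c d : \det (mx22 a b c d) = a * d - b * c.
Proof.
by rewrite (expand_det_row _ 0) !big_ord_recl big_ord0 /cofactor !det_mx11 !mxE /=; ring.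
Qed.

Lemma mx22_1 : mx22 1 0 0 1 = 1%:M :> 'M[C]_2.
Proof.
apply/matrixP=> i j; rewrite !mxE.
by case: ifP => [/eqP -> | /i2_eq1 ->]; case: ifP => [/eqP -> | /i2_eq1 ->].
Qed.

Lemma invmx22 a b c d :
  a * d - b * c = 1 -> invmx (mx22 a b c d) = mx22 d (- b) (- c) a.
Proof.
move=> D1; have mul1 : mx22 a b c d *m mx22 d (- b) (- c) a = 1%:M.
  by rewrite -mx22_1 mx22_mul; congr mx22; rewrite -?D1; ring.
have [U _] := mulmx1_unit mul1.
by rewrite -[LHS]mulmx1 -mul1 mulmxA mulVmx // mul1mx.
Qed.

(** The trace condition is a separate hypothesis, so that the lemma rewrites matrix products whose
    diagonal entries are opposite only after [ring]. *)
Lemma coord_sl2 a b c d (i : 'I_3) : d = - a ->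
  coord (sl2_basis R) i (mx22 a b c d) =
  [:: (b + c) / 2; (c - b) * 'i / 2; a]`_i.
Proof.
move->.
pose k (i : 'I_3) : C := [:: (b + c) / 2; (c - b) * 'i / 2; a]`_i.
have -> : mx22 a b c (- a) = \sum_(i < 3) k i *: (sl2_basis R)`_i.
  have i2 : 'i * 'i = -1 :> C by rewrite -sqr_i expr2.
  have iN : (0 -i* 1) = - 'i :> C by apply/eqP; rewrite eq_complex /= oppr0 !eqxx.
  rewrite !big_ord_recl big_ord0 /k /=; apply/matrixP => x y.
  rewrite !mxE iN; case: ifP => _; case: ifP => _; rewrite ?mulr0 ?mulr1 ?addr0 ?add0r //.
  - by rewrite -!mulrA -[2^-1 * 'i]mulrC !mulrA -[_ * 'i * 'i]mulrA i2; field.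
  - by rewrite mulrN -!mulrA -[2^-1 * 'i]mulrC !mulrA -[_ * 'i * 'i]mulrA i2; field.
  - by rewrite mulrN1.
by rewrite coord_sum_free // (basis_free (sl2_basisP R)).
Qed.

Lemma cmx22E a b c d (i j : 'I_3) : a * d - b * c = 1 ->
  cmx (mx22 a b c d) i j =
  (nth [::] [::
    [:: (a ^+ 2 - b ^+ 2 + d ^+ 2 - c ^+ 2) / 2;
        'i * (a ^+ 2 + b ^+ 2 - c ^+ 2 - d ^+ 2) / 2;
        c * d - a * b];
    [:: 'i * (b ^+ 2 - a ^+ 2 + d ^+ 2 - c ^+ 2) / 2;
        (a ^+ 2 + b ^+ 2 + c ^+ 2 + d ^+ 2) / 2;
        'i * (a * b + c * d)];
    [:: b * d - a * c; - 'i * (a * c + b * d); a * d + b * c]] i)`_j.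
Proof.
move=> D1; rewrite mxE invmx22 //.
have iN : (0 -i* 1) = - 'i :> C by apply/eqP; rewrite eq_complex /= oppr0 !eqxx.
have i2 : 'i * 'i = -1 :> C by rewrite -sqr_i expr2.
have -> : (sl2_basis R)`_j =
    [:: mx22 0 1 1 0; mx22 0 'i (- 'i) 0; mx22 1 0 0 (-1)]`_j.
  by rewrite /sl2_basis iN.
case: j => [[|[|[|//]]] ?] /=; rewrite !mx22_mul.
- by rewrite coord_sl2; [case: i => [[|[|[|//]]] ?] /=; field | ring].
- rewrite coord_sl2; last by ring.
  case: i => [[|[|[|//]]] ?] /=; try by field.
  transitivity ('i * 'i * (- (a ^+ 2 + b ^+ 2 + c ^+ 2 + d ^+ 2) / 2)).
    by field.
  by rewrite i2; field.
- by rewrite coord_sl2; [case: i => [[|[|[|//]]] ?] /=; field | ring].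
Qed.

End Matrices.

(** * Gaussian integers and a lower bound for |u|^2 + |v|^2 *)

Section GaussianIntegers.
Variable R : realType.
Local Notation C := R[i].
Implicit Types u v : C.

Lemma gaussian_intD u v :
  gaussian_int u -> gaussian_int v -> gaussian_int (u + v).
Proof.
by case: u v => [a b] [c d] /andP[? ?] /andP[? ?]; rewrite /gaussian_int /= !rpredD.
Qed.

Lemma gaussian_intM u v :
  gaussian_int u -> gaussian_int v -> gaussian_int (u * v).
Proof.
case: u v => [a b] [c d] /andP[/= ? ?] /andP[/= ? ?].
by apply/andP; split; [apply: rpredB | apply: rpredD]; exact: rpredM.
Qed.

Lemma gaussian_int_i : gaussian_int ('i : C).
Proof. by rewrite /gaussian_int /= rpred0 rpred1. Qed.

Lemma gaussian_intN u : gaussian_int u -> gaussian_int (- u).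
Proof. by case: u => a b /andP[? ?]; rewrite /gaussian_int /= !rpredN; apply/andP. Qed.

Lemma gaussian_intB u v :
  gaussian_int u -> gaussian_int v -> gaussian_int (u - v).
Proof. by move=> ? ?; exact/gaussian_intD/gaussian_intN. Qed.

(** Squared modulus, valued in [R] so that all estimates take place in a totally ordered field. *)
Definition normsq u : R := complex.Re u ^+ 2 + complex.Im u ^+ 2.

Lemma normsq_ge0 u : 0 <= normsq u.
Proof. by rewrite addr_ge0 ?sqr_ge0. Qed.

Lemma gaussian_int_normsq_ge1 u : gaussian_int u -> u != 0 -> 1 <= normsq u.
Proof.
have sqr_ge1 (x : R) : x \is a Num.int -> x != 0 -> 1 <= x ^+ 2.
  by move=> ? ?; rewrite -real_normK ?num_real // exprn_ege1 // norm_intr_ge1.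
case: u => a b /andP[/= aZ bZ]; rewrite eq_complex negb_and /normsq /=.
move=> /orP[a0|b0].
- by apply: (le_trans (sqr_ge1 _ aZ a0)); rewrite lerDl sqr_ge0.
- by apply: (le_trans (sqr_ge1 _ bZ b0)); rewrite lerDr sqr_ge0.
Qed.

(** Both u^2 + v^2 and v^2 - u^2 have modulus at most |u|^2 + |v|^2, and they vanish together only
    for u = v = 0. So one of them is a nonzero Gaussian integer, of modulus at least 1. *)
Lemma normsq_sum_sqr_ge1 u v :
  gaussian_int (u ^+ 2 + v ^+ 2) -> gaussian_int (v ^+ 2 - u ^+ 2) ->
  (u, v) != 0 -> 1 <= normsq u + normsq v.
Proof.
move=> addZ subZ uv0.
have N0 : 0 <= normsq u + normsq v by rewrite addr_ge0 ?normsq_ge0.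
have sqN_ge1 (w : C) : gaussian_int w -> w != 0 ->
    normsq w <= (normsq u + normsq v) ^+ 2 -> 1 <= normsq u + normsq v.
  move=> wZ w0 wN; rewrite -(expr_ge1 (n := 2)) //.
  exact: le_trans (gaussian_int_normsq_ge1 wZ w0) wN.
have [add0|add0] := eqVneq (u ^+ 2 + v ^+ 2) 0; last first.
  apply: sqN_ge1 add0 _ => //; rewrite -subr_ge0.
  (* With w the product of u and the conjugate of v, the difference is 2 |w|^2 - 2 Re (w^2); for v^2
     - u^2 the second sign flips and Re w replaces Im w. *)
  suff -> : (normsq u + normsq v) ^+ 2 - normsq (u ^+ 2 + v ^+ 2) =
    4 * complex.Im (u * v^*%C) ^+ 2 by rewrite mulr_ge0 ?sqr_ge0.
  by case: u v {addZ subZ uv0 N0} => [a b] [c d]; rewrite /normsq !expr2 /=; ring.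
have [sub0|sub0] := eqVneq (v ^+ 2 - u ^+ 2) 0; last first.
  apply: sqN_ge1 sub0 _ => //; rewrite -subr_ge0.
  suff -> : (normsq u + normsq v) ^+ 2 - normsq (v ^+ 2 - u ^+ 2) =
    4 * complex.Re (u * v^*%C) ^+ 2 by rewrite mulr_ge0 ?sqr_ge0.
  by case: u v {addZ subZ uv0 N0 add0} => [a b] [c d]; rewrite /normsq !expr2 /=; ring.
have two0 : 2 != 0 :> C by rewrite pnatr_eq0.
have v0 : v = 0.
  apply/eqP; rewrite -sqrf_eq0; apply/eqP/(mulfI two0).
  transitivity ((u ^+ 2 + v ^+ 2) + (v ^+ 2 - u ^+ 2)); first by ring.
  by rewrite add0 sub0; ring.
move: add0; rewrite v0 expr0n addr0 => /eqP; rewrite sqrf_eq0 => /eqP u0.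
by rewrite u0 v0 eqxx in uv0.
Qed.

End GaussianIntegers.

(** * The height of a translate, and its bound over the group *)

Section Height.
Variable R : realType.
Local Notation C := R[i].
Implicit Types (g : 'M[C]_2) (x y : R).

(** The first row of [cmx g] minus i times the second is (d^2 - c^2, - i (c^2 + d^2), 2 c d): a and
    b cancel, and so do the denominators 2. *)
Lemma Gamma_bottom_row g : Gamma g ->
  [/\ gaussian_int (g 1 0 ^+ 2 + g 1 1 ^+ 2),
      gaussian_int (g 1 1 ^+ 2 - g 1 0 ^+ 2)
    & gaussian_int (2 * g 1 0 * g 1 1)].
Proof.
have i2 : 'i * 'i = -1 :> C by rewrite -sqr_i expr2.
case=> D1 [_]; rewrite /SL2 /= in D1.
set a := g 0 0; set b := g 0 1; set c := g 1 0; set d := g 1 1.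
rewrite [g]mx22E det_mx22 -/a -/b -/c -/d in D1 * => gZ.
have E i j := cmx22E i j D1.
have Z00 := gZ 0 0; have Z01 := gZ 0 1; have Z02 := gZ 0 2.
have Z10 := gZ 1 0; have Z11 := gZ 1 1; have Z12 := gZ 1 2.
rewrite !E /= in Z00 Z01 Z02 Z10 Z11 Z12.
have iZ := gaussian_int_i R; split.
- suff -> : c ^+ 2 + d ^+ 2 =
    (a ^+ 2 + b ^+ 2 + c ^+ 2 + d ^+ 2) / 2
    + 'i * ('i * (a ^+ 2 + b ^+ 2 - c ^+ 2 - d ^+ 2) / 2).
    by apply: gaussian_intD => //; exact: gaussian_intM.
  by rewrite !mulrA i2; field.
- suff -> : d ^+ 2 - c ^+ 2 =
    (a ^+ 2 - b ^+ 2 + d ^+ 2 - c ^+ 2) / 2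
    - 'i * ('i * (b ^+ 2 - a ^+ 2 + d ^+ 2 - c ^+ 2) / 2).
    by apply: gaussian_intB => //; exact: gaussian_intM.
  by rewrite !mulrA i2; field.
- suff -> : 2 * c * d = c * d - a * b - 'i * ('i * (a * b + c * d)).
    by apply: gaussian_intB => //; exact: gaussian_intM.
  by rewrite !mulrA i2; ring.
Qed.

Lemma SL2_bottom_row g : \det g = 1 -> (g 1 0, g 1 1) != 0.
Proof.
rewrite [g]mx22E det_mx22 !mxE /= => D1.
apply/eqP => -[c0 d0]; move: D1; rewrite c0 d0 !mulr0 subrr => /esym/eqP.
by rewrite oner_eq0.
Qed.

Lemma Gamma_denominator_ge1 g x y : Gamma g -> 0 <= x <= 2 ->
  2 <= (x - 1) ^+ 2 + y ^+ 2 ->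
  1 <= normsq (g 1 0 * x%:C + g 1 1) + normsq (g 1 0) * y ^+ 2.
Proof.
move=> Gg /andP[x0 x2] xy; have [addZ subZ mulZ] := Gamma_bottom_row Gg.
have cd0 : (g 1 0, g 1 1) != 0 by apply: SL2_bottom_row; case: Gg.
move: addZ subZ mulZ cd0; set c := g 1 0; set d := g 1 1 => addZ subZ mulZ cd0.
have N0 : 1 <= normsq c + normsq d by exact: normsq_sum_sqr_ge1.
have sqrcZ : gaussian_int (2 * c ^+ 2).
  suff -> : 2 * c ^+ 2 = (c ^+ 2 + d ^+ 2) - (d ^+ 2 - c ^+ 2).
    exact: gaussian_intB.
  by ring.
(* The pair (c, d + 2 c) is the bottom row of g T_1^2. Passing from d to d + 2 c adds 4 c d + 4 c^2
   to d^2, a Gaussian integer by [mulZ] and [sqrcZ]. *)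
have N2 : 1 <= normsq c + normsq (d + 2 * c).
  have mulZ2 : gaussian_int (2 * (2 * c * d) + 2 * (2 * c ^+ 2)).
    have dblZ w : gaussian_int w -> gaussian_int (2 * w).
      by move=> wZ; rewrite mulr_natl mulr2n gaussian_intD.
    by apply: gaussian_intD; exact: dblZ.
  apply: normsq_sum_sqr_ge1.
  - suff -> : c ^+ 2 + (d + 2 * c) ^+ 2 =
      c ^+ 2 + d ^+ 2 + (2 * (2 * c * d) + 2 * (2 * c ^+ 2)).
      exact: gaussian_intD.
    by ring.
  - suff -> : (d + 2 * c) ^+ 2 - c ^+ 2 =
      d ^+ 2 - c ^+ 2 + (2 * (2 * c * d) + 2 * (2 * c ^+ 2)).
      exact: gaussian_intD.
    by ring.
  - apply: contra cd0 => /eqP[c0]; rewrite c0 mulr0 addr0 => ->.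
    by rewrite eqxx.
(* On the hemisphere (x - 1)^2 + y^2 = 2 one has x^2 + y^2 = 2 x + 1, so the denominator is affine
   in x there and interpolates its values at j and 2 + j. The last term corrects for points off the
   hemisphere. *)
suff -> : normsq (c * x%:C + d) + normsq c * y ^+ 2 =
    (1 - x / 2) * (normsq c + normsq d) + x / 2 * (normsq c + normsq (d + 2 * c))
    + normsq c * ((x - 1) ^+ 2 + y ^+ 2 - 2).
  have := normsq_ge0 c; set n := normsq c in N0 N2 *; nra.
by rewrite /normsq; case: c d {addZ subZ mulZ cd0 N0 N2 sqrcZ} => [p q] [r s] /=; field.
Qed.

Lemma H2_to_H3E x y : H2_to_H3 (x +i* y) = (x%:C, y%:C).
Proof.
by rewrite /H2_to_H3 [LHS]surjective_pairing /=; congr pair;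
  rewrite ?(rmorph0, rmorph1); ring.
Qed.

Lemma H3P (q : quat R) : H3 q <-> exists u y, 0 < y /\ q = (u, y%:C).
Proof.
have E u y : quat_of_complex u + quat_of_complex y%:C * quat_j R = (u, y%:C).
  by rewrite [LHS]surjective_pairing /=; congr pair;
    rewrite ?(rmorph0, rmorph1); ring.
split=> [[u _ [y y0 <-]]|[u [y [y0 ->]]]].
  by exists u, y; rewrite E.
by exists u => //; exists y => //; rewrite E.
Qed.

Lemma conj_normsq (u : C) : u * u^* = (normsq u)%:C.
Proof.
case: u => a b; rewrite -[Num.conj _]/(a -i* b); apply/eqP.
rewrite eq_complex /= /normsq /=; apply/andP; split; apply/eqP; ring.
Qed.

Lemma quat_affine (a b u v : C) :
  quat_of_complex a * (u, v) + quat_of_complex b = (a * u + b, a * v) :> quat R.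
Proof. by rewrite [LHS]surjective_pairing /=; congr pair; ring. Qed.

Lemma yH3_act g (u : C) y : \det g = 1 ->
  yH3 (actH3 g (u, y%:C)) =
  y / (normsq (g 1 0 * u + g 1 1) + normsq (g 1 0) * y ^+ 2).
Proof.
rewrite {1}[g]mx22E det_mx22 => D1.
set N := normsq _ + _.
have -> : y / N = complex.Re (y%:C / N%:C) by rewrite -fmorphV -rmorphM.
congr complex.Re; rewrite /actH3.
pose q : quat R := (g 1 0 * u + g 1 1, g 1 0 * y%:C).
rewrite !quat_affine -/q.
rewrite -[q^-1]/(quat_inv q).
have qN : quat_norm2 q = N%:C.
  rewrite /quat_norm2 /= !conj_normsq -rmorphD; congr _%:C.
  rewrite /N; congr (_ + _); rewrite /normsq.
  by case: (g 1 0) => c d /=; ring.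
(* This is the j-component of the quotient. Its terms in u cancel, leaving y (a d - b c) / N with
   determinant 1. *)
transitivity ((g 0 0 * u + g 0 1) * (- q.2 / quat_norm2 q)
  + g 0 0 * y%:C * (q.1^* / quat_norm2 q)^*); first by [].
rewrite qN /= rmorphM /= conjCK.
rewrite fmorphV /= -[Num.conj N%:C]/(conjc N%:C) conjc_real.
rewrite -[y%:C in RHS]mulr1 -D1; ring.
Qed.

(** For real entries both sides are y / |c (x + i y) + d|^2, so the estimates in H^3 also serve
    H^2. *)
Lemma Im_actH2 g x y : SL2R g ->
  complex.Im (actH2 g (x +i* y)) = yH3 (actH3 g (x%:C, y%:C)).
Proof.
case=> h D1 <-.
have D1' : \det (map_mx (real_complex R) h) = 1 by rewrite det_map_mx D1 rmorph1.
rewrite yH3_act // /actH2 !mxE.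
move: D1'; rewrite [map_mx _ _]mx22E det_mx22 !mxE -!rmorphM -rmorphB => -[{}D1].
rewrite /normsq /=; set n1 := _ ^+ 2 + _; set n2 := _ + _ * y ^+ 2.
have -> : n1 = n2 by rewrite /n1 /n2; ring.
by rewrite -[y in RHS]mulr1 -D1; ring.
Qed.

End Height.

(** * The two domains in coordinates, and the half-turn relating them *)

Section FundamentalDomains.
Variable R : realType.
Local Notation C := R[i].
Implicit Types (x y : R).

(** An elliptic element fixing j, whose isometric sphere is the hemisphere of centre 1 and radius
    sqrt 2. *)
Definition hemisphere_mx : 'M[C]_2 :=
  let s := ((Num.sqrt 2)^-1)%:C in mx22 s s (- s) s.

(** Conjugation sends X_1 to Y, Y to - X_1 and fixes X_2, which gives a signed permutation matrix of
    determinant 1. *)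
Lemma hemisphere_mx_GammaR : GammaR hemisphere_mx.
Proof.
set s : R := (Num.sqrt 2)^-1.
have s2 : s%:C * s%:C = 2^-1 :> C.
  by rewrite -rmorphM -expr2 exprVn sqr_sqrtr // fmorphV rmorph_nat.
have D1 : s%:C * s%:C - s%:C * - s%:C = 1 :> C by rewrite mulrN s2; field.
have E : hemisphere_mx = mx22 s%:C s%:C (- s%:C) s%:C by [].
have cE : cmx hemisphere_mx =
    \matrix_(i, j) (nth [::] [:: [:: 0; 0; -1]; [:: 0; 1; 0]; [:: 1; 0; 0]] i)`_j.
  apply/matrixP => i j; rewrite E cmx22E // mxE !expr2 ?mulrNN ?mulrN ?mulNr s2.
  by case: i => [[|[|[|//]]] ?]; case: j => [[|[|[|//]]] ?] /=; field.
split; last first.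
  exists (\matrix_(i, j) if (i == 1) && (j == 0) then - s else s).
    rewrite /SL2 /=.
    (* The real determinant is computed after embedding in C, where [det_mx22] is stated. *)
    apply: (@complexI R); rewrite -det_map_mx [map_mx _ _]mx22E det_mx22 !mxE /=.
    by rewrite rmorphN D1.
  rewrite [LHS]mx22E E !mxE /= rmorphN //.
split; first by rewrite /SL2 /= E det_mx22.
split.
  split.
    apply/matrixP => i j; rewrite !mxE cE !big_ord_recl big_ord0 !mxE.
    by case: i => [[|[|[|//]]] ?]; case: j => [[|[|[|//]]] ?] /=; ring.
  rewrite cE (expand_det_row _ 0) !big_ord_recl big_ord0 !mxE /= !mul0r !add0r addr0.
  rewrite /cofactor (expand_det_row _ 0) !big_ord_recl big_ord0 /cofactor.
  by rewrite !det_mx11 !mxE /=; ring.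
move=> i j; rewrite cE mxE /gaussian_int.
by case: i => [[|[|[|//]]] ?]; case: j => [[|[|[|//]]] ?] /=;
  rewrite ?(oppr0, rpredN, rpred0, rpred1).
Qed.

Lemma yH3_hemisphere x y : yH3 (actH3 hemisphere_mx (x%:C, y%:C)) =
  y / (((x - 1) ^+ 2 + y ^+ 2) / 2).
Proof.
have [[D1 _] _] := hemisphere_mx_GammaR.
rewrite yH3_act // !mxE /=; congr (_ / _); rewrite /normsq /=.
set s := (Num.sqrt 2)^-1.
have s2 : s ^+ 2 = 2^-1 by rewrite exprVn sqr_sqrtr.
transitivity (s ^+ 2 * ((x - 1) ^+ 2 + y ^+ 2)); first by ring.
by rewrite s2 mulrC.
Qed.

Lemma hemisphere_height x y : 0 < y ->
  yH3 (actH3 hemisphere_mx (x%:C, y%:C)) <= y -> 2 <= (x - 1) ^+ 2 + y ^+ 2.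
Proof.
move=> y0; have N0 : 0 < (x - 1) ^+ 2 + y ^+ 2 by rewrite ltr_wpDl ?sqr_ge0 ?exprn_gt0.
by rewrite yH3_hemisphere ler_pdivrMr ?divr_gt0 // ler_pMr // ler_pdivlMr ?mul1r.
Qed.

Lemma Gamma_height g x y : Gamma g -> 0 < y -> 0 <= x <= 2 ->
  2 <= (x - 1) ^+ 2 + y ^+ 2 -> yH3 (actH3 g (x%:C, y%:C)) <= y.
Proof.
move=> Gg y0 x02 xy; rewrite yH3_act; last by case: Gg.
have N1 := Gamma_denominator_ge1 Gg x02 xy.
by rewrite ler_pdivrMr ?(lt_le_trans ltr01) // ler_pMr.
Qed.

Lemma calFRP x y : calFR (@calGR R) (x +i* y) <->
  [/\ 0 < y, 0 <= x <= 2 & 2 <= (x - 1) ^+ 2 + y ^+ 2].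
Proof.
rewrite /calFR /H2 /calGR /= in_itv /=; split=> -[y0 x02 H]; split=> //.
  apply: hemisphere_height => //; rewrite -Im_actH2; last first.
    by case: hemisphere_mx_GammaR.
  exact/H/hemisphere_mx_GammaR.
by move=> g [Gg /Im_actH2 ->]; exact: Gamma_height.
Qed.

Lemma calG_real x : calG x%:C <-> 1 <= x <= 2.
Proof.
split=> [[r [s [t [r0 s0 t0 rst /eqP]]]]|/andP[x1 x2]].
  (* The imaginary part of the combination is t, so [tE] forces t = 0 and x = r + 2 s with r + s =
     1. *)
  by rewrite eq_complex /= => /andP[/eqP xE /eqP tE]; apply/andP; split; nra.
exists (2 - x), (x - 1), 0; split; rewrite ?subr_ge0 //; first by ring.
by apply/eqP; rewrite eq_complex /=; apply/andP; split; apply/eqP; ring.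
Qed.

Lemma calFP x y : calF (@calG R) (x%:C, y%:C) <->
  [/\ 0 < y, 1 <= x <= 2 & 2 <= (x - 1) ^+ 2 + y ^+ 2].
Proof.
rewrite /calF /=; split=> [[/H3P[u [y' [y0 [_ yE]]]] /calG_real x12 H]|[y0 x12 xy]].
  rewrite -{y'}yE in y0.
  split=> //; apply: hemisphere_height => //.
  by apply: H; case: hemisphere_mx_GammaR.
split; [by apply/H3P; exists x%:C, y | exact/calG_real |].
move=> g Gg; apply: Gamma_height => //.
by case/andP: x12 => x1 ->; rewrite (le_trans ler01).
Qed.

Lemma omega8_sqr : @omega8 R ^+ 2 = 'i.
Proof.
have E : pi / 4 + pi / 4 = pi / 2 :> R by field.
apply/eqP; rewrite eq_complex expr2 /= -cosD E cos_pihalf eqxx /=.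
by rewrite addrC -sinD E sin_pihalf.
Qed.

(** R_{pi/2}^2 = diag(i, - i) is the half-turn u |-> - u about the vertical axis; conjugating by T_1
    moves the axis over 1. *)
Lemma actH3_rotation (u v : C) :
  actH3 (T1 R *m Rpi2 R ^+ 2 *m invmx (T1 R)) (u, v) = (2 - u, v).
Proof.
have T1V : invmx (T1 R) = mx22 1 (- 1) 0 1.
  by rewrite invmx22 ?oppr0 //; ring.
have E : T1 R *m Rpi2 R ^+ 2 *m invmx (T1 R) = mx22 'i (- 2 * 'i) 0 (- 'i).
  have iV : (omega8 R)^-1 * (omega8 R)^-1 = - 'i.
    by rewrite -invfM -expr2 omega8_sqr invCi.
  rewrite T1V expr2 -[Rpi2 R * Rpi2 R]/(Rpi2 R *m Rpi2 R) !mx22_mul.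
  rewrite !(mul0r, mulr0, mul1r, mulr1, addr0, add0r) iV -expr2 omega8_sqr.
  by congr mx22; rewrite mulrN1 mulNr mulr_natl mulr2n opprD.
rewrite E /actH3 !mxE /=.
rewrite !quat_affine.
have -> : (0 * u - 'i, 0 * v) = (- 'i, 0) :> quat R by congr pair; ring.
pose q : quat R := (- 'i, 0).
have N1 : quat_norm2 q = 1.
  by apply/eqP; rewrite eq_complex /=; apply/andP; split; apply/eqP; ring.
rewrite -/q -[q^-1]/(quat_inv q).
have -> : quat_inv q = ('i, 0).
  rewrite /quat_inv N1 !divr1 /q /= oppr0; congr pair.
  by apply/eqP; rewrite eq_complex /= !(oppr0, opprK) !eqxx.
have iJ : Num.conj ('i : C) = - 'i.
  by rewrite -[LHS]/(0 -i* 1); apply/eqP; rewrite eq_complex /= oppr0 !eqxx.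
(* Right multiplication by (i, 0) conjugates i in the j-component, so v gets the factor i (- i) = 1,
   while the complex component becomes i^2 (u - 2). *)
transitivity (('i * u + -2 * 'i) * 'i - 'i * v * Num.conj 0,
              ('i * u + -2 * 'i) * 0 + 'i * v * Num.conj 'i) => //.
rewrite iJ rmorph0 !mulr0 subr0 add0r; congr pair.
- transitivity ('i ^+ 2 * (u - 2)); first by ring.
  by rewrite sqr_i; ring.
- transitivity (- 'i ^+ 2 * v); first by ring.
  by rewrite sqr_i opprK mul1r.
Qed.

End FundamentalDomains.

Theorem proposition1p3p2p10 (R : realType) :
  @H2_to_H3 R @` calFR (@calGR R) =
  (calF (@calG R)
   `|` actH3 (T1 R *m Rpi2 R ^+ 2 *m invmx (T1 R)) @` calF (@calG R))
  `&` @H2j R.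
Proof.
apply/seteqP; split=> [_ [[x y] /calFRP[y0 /andP[x0 x2] xy] <-]|q [qF [/H3P[u [y [y0 qE]]]]]].
  rewrite H2_to_H3E; split; last by split=> //; apply/H3P; exists x%:C, y.
  (* The triangle meets the real line in [1, 2]; the half-turn, which preserves (x - 1)^2 + y^2,
     supplies the remaining points x < 1. *)
  have [x1|x1] := leP 1 x; first by left; apply/calFP; rewrite x1.
  right; exists ((2 - x)%:C, y%:C).
    apply/calFP; split=> //; first by apply/andP; split; lra.
    by move: xy; rewrite -[(2 - x - 1) ^+ 2]sqrrN !opprB; congr (_ <= _ ^+ 2 + _); ring.
  by rewrite actH3_rotation rmorphB rmorph_nat; congr pair; ring.
move: qF; rewrite {q}qE /xH3 /= => qF.
case: u qF => x x' /= qF x'0; rewrite {x'}x'0 in qF *.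
exists (x +i* y); last exact: H2_to_H3E.
case: qF => [/calFP[_ /andP[x1 x2] xy]|[[u v] uvF]].
  by apply/calFRP; split=> //; rewrite x2 (le_trans ler01).
rewrite actH3_rotation => -[uE vE].
(* The half-turn is an involution, so u is real as well and [calFP] applies to the preimage. *)
have {}uE : u = (2 - x)%:C.
  transitivity (2 - (2 - u)); first by ring.
  by rewrite uE rmorphB rmorph_nat.
move: uvF; rewrite uE vE => /calFP[_ /andP[x1 x2] xy].
apply/calFRP; split=> //; first by apply/andP; split; lra.
by move: xy; rewrite -[(2 - x - 1) ^+ 2]sqrrN; congr (_ <= _ ^+ 2 + _); ring.
Qed.
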